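(* Let $m$, $n$ and $q$ be positive integers such that $q$ is even or $mnq$ is odd. Then \[ \sum_{k = 1}^\infty (-1)^{k-1}\frac{F_{nk+mnq}}{\prod_{j=0}^{2m} L_{nk+jnq}} = \frac{1}{5F_{mnq}}\sum_{k=1}^{q}\left[(-1)^{k-1}\prod_{j=0}^{2m-1}\frac{1}{L_{nk+jnq}}\right]. \]
   Context: The Fibonacci numbers are defined by $F_0=0$, $F_1=1$, $F_n=F_{n-1}+F_{n-2}$, and the Lucas numbers by $L_0=2$, $L_1=1$, $L_n=L_{n-1}+L_{n-2}$. Infinite sums are limits of partial sums. *)

(* Defs.v *)
From mathcomp Require Import all_boot.

Set Implicit Arguments.
Unset Strict Implicit.
Unset Printing Implicit Defensive.

Fixpoint fib (n : nat) : nat :=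
  match n with
  | 0 => 0
  | n1.+1 => match n1 with 0 => 1 | n2.+1 => fib n1 + fib n2 end
  end.

Fixpoint lucas (n : nat) : nat :=
  match n with
  | 0 => 2
  | n1.+1 => match n1 with 0 => 1 | n2.+1 => lucas n1 + lucas n2 end
  end.

(* Main.v *)
(** Write [T k] ([lucas_term k]) for the [k]-th summand of the finite sum on the right. Since
    [L_(x+2d) - (-1)^d L_x = 5 F_(x+d) F_d] with [d = mnq], and the parity
    hypothesis makes [(-1)^d = (-1)^q], the [k]-th term of the series is
    [(T k - T (k+q)) / (5 F_d)]. The series therefore telescopes with step [q],
    leaving the first [q] values of [T] minus [q] consecutive values of [T]
    that tend to [0]. *)

Require Import Defs.
From mathcomp Require Import all_boot all_order all_algebra.
From mathcomp Require Import all_classical all_reals all_analysis.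
From mathcomp Require Import ring zify.

Set Implicit Arguments.
Unset Strict Implicit.
Unset Printing Implicit Defensive.

Import Order.TTheory GRing.Theory Num.Theory.
Import numFieldNormedType.Exports.

Local Open Scope classical_set_scope.
Local Open Scope ring_scope.

Lemma fibSS n : fib n.+2 = (fib n.+1 + fib n)%N.
Proof. by []. Qed.

Lemma lucasSS n : lucas n.+2 = (lucas n.+1 + lucas n)%N.
Proof. by []. Qed.

Lemma fib_addnS x y :
  fib (x + y).+1 = (fib x.+1 * fib y.+1 + fib x * fib y)%N.
Proof.
elim: x y => [|x IHx] y; first by rewrite add0n /= mul1n mul0n addn0.
rewrite addSnnS IHx !fibSS; lia.
Qed.

(** Stated additively to avoid truncated subtraction. The induction carries two consecutive cases,
    as the recurrences have order two. *)
Lemma lucas_fib n : (lucas n + fib n = 2 * fib n.+1)%N.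
Proof.
suff: (lucas n + fib n = 2 * fib n.+1)%N /\
      (lucas n.+1 + fib n.+1 = 2 * fib n.+2)%N by case.
elim: n => [//|n [IH0 IH1]]; split=> //.
rewrite lucasSS (fibSS n.+1); rewrite (fibSS n) in IH1 *; lia.
Qed.

Lemma fib_gt0 n : (0 < n)%N -> (0 < fib n)%N.
Proof.
case: n => // n _; elim: n => // n IHn.
by rewrite fibSS addn_gt0 IHn.
Qed.

Lemma lucas_gt0 n : (0 < lucas n)%N.
Proof.
have := lucas_fib n; case: n => // n; have := fib_gt0 (ltn0Sn n).
rewrite fibSS; lia.
Qed.

(** This crude linear bound is enough to compare the summands with the harmonic sequence. *)
Lemma leq_lucas n : (n <= lucas n)%N.
Proof.
suff: (n <= lucas n)%N /\ (n.+1 <= lucas n.+1)%N by case.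
elim: n => [//|n [IH0 IH1]]; split=> //; rewrite lucasSS.
have := lucas_gt0 n; lia.
Qed.

Section RingIdentities.
Variable R : comNzRingType.

(** Cassini's identity with $F_{n-1}$ eliminated, which turns the sign into a polynomial in $F_n$
    and $F_{n+1}$. *)
Lemma fib_cassini n :
  (-1) ^+ n = (fib n.+1)%:R ^+ 2 - (fib n)%:R * (fib n.+1)%:R
              - (fib n)%:R ^+ 2 :> R.
Proof.
elim: n => [|n IHn]; first by rewrite /=; ring.
rewrite exprS IHn fibSS natrD; ring.
Qed.

(** Both sides become polynomials in $F_x$, $F_{x+1}$, $F_d$, $F_{d+1}$, and [ring] compares
    them. *)
Lemma lucas_sub_fib_mul x d :
  (lucas (x + 2 * d))%:R - (-1) ^+ d * (lucas x)%:R
  = 5 * (fib d)%:R * (fib (x + d))%:R :> R.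
Proof.
have natL k : (lucas k)%:R = 2 * (fib k.+1)%:R - (fib k)%:R :> R.
  by apply/eqP; rewrite eq_sym subr_eq -natrD -natrM lucas_fib.
have addS y z : (fib (y + z).+1)%:R =
    (fib y.+1)%:R * (fib z.+1)%:R + (fib y)%:R * (fib z)%:R :> R.
  by rewrite fib_addnS natrD !natrM.
(* The factor $F_{z+1} - F_z$ stands for $F_{z-1}$, so that $z = 0$ is covered. The formula comes
   from expanding $F_{y+z+2}$ in two ways. *)
have addE y z : (fib (y + z))%:R = (fib y)%:R * ((fib z.+1)%:R - (fib z)%:R)
    + (fib y.+1)%:R * (fib z)%:R :> R.
  have: (fib (y + z.+1).+1)%:R =
        (fib (y + z).+1)%:R + (fib (y + z))%:R :> R.
    by rewrite addnS fibSS natrD.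
  rewrite !addS (fibSS z) natrD => e.
  by apply: (addrI ((fib y.+1)%:R * (fib z.+1)%:R + (fib y)%:R * (fib z)%:R));
    rewrite -e; ring.
rewrite !natL fib_cassini mul2n -addnn !(addS, addE); ring.
Qed.

End RingIdentities.

Lemma sum_sub_shift (V : zmodType) (T : nat -> V) (q N : nat) :
  \sum_(1 <= k < N.+1) (T k - T (k + q)%N)
  = \sum_(1 <= k < q.+1) T k - \sum_(1 <= k < q.+1) T (k + N)%N.
Proof.
elim: N => [|N IHN].
  rewrite big_geq //; under [X in _ - X]eq_bigr do rewrite addn0.
  by rewrite subrr.
rewrite big_nat_recr //= IHN -addrA; congr (_ + _).
have -> : \sum_(1 <= k < q.+1) T (k + N.+1)%N =
          \sum_(1 <= k < q.+1) T (k + N)%N - T N.+1 + T (N.+1 + q)%N.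
  pose G k := T (k + N)%N.
  (* The same $q+1$ consecutive terms are split at the last one on the left and at the first one on
     the right. *)
  have : \sum_(1 <= k < q.+2) G k = \sum_(1 <= k < q.+2) G k by [].
  rewrite {1}big_nat_recr //= [RHS]big_ltn // [X in _ = _ + X]big_add1 /=.
  rewrite /G add1n => E.
  rewrite addrAC [(N.+1 + q)%N]addnC -addSnnS E addrAC subrr add0r.
  by apply: eq_bigr => k _; rewrite addSnnS.
by rewrite !opprD opprK addrA.
Qed.

Lemma natr_lucas_neq0 (R : numDomainType) k : (lucas k)%:R != 0 :> R.
Proof. by rewrite pnatr_eq0 -lt0n lucas_gt0. Qed.

Section InverseLucasProduct.
Variables (R : realType) (m n q : nat).

Definition lucas_term (k : nat) : R :=
  (-1) ^+ k.-1 *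
  \prod_(0 <= j < 2 * m) (1 / (lucas (n * k + j * n * q))%:R).

Lemma lucas_term_sub_shift k : (0 < n)%N -> (0 < m)%N -> (0 < q)%N ->
  (0 < k)%N -> ~~ odd q \/ odd (m * n * q) ->
  (-1) ^+ k.-1 * ((fib (n * k + m * n * q))%:R /
     \prod_(0 <= j < (2 * m).+1) (lucas (n * k + j * n * q))%:R)
  = 1 / (5 * (fib (m * n * q))%:R) * (lucas_term k - lucas_term (k + q)).
Proof.
move=> n0 m0 q0 k0 hpar.
have sgE : (-1) ^+ q = (-1) ^+ (m * n * q) :> R.
  rewrite -signr_odd -[RHS]signr_odd; congr (_ ^+ nat_of_bool _).
  by case: hpar; rewrite !oddM; case: (odd q); rewrite ?andbF ?andbT // => ->.
have kq : ((k + q).-1 = k.-1 + q)%N by lia.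
rewrite /lucas_term kq exprD sgE.
pose P : R := \prod_(0 <= j < (2 * m).+1) (lucas (n * k + j * n * q))%:R.
have P0 : P != 0.
  by rewrite prodf_seq_neq0; apply/allP => j _; exact: natr_lucas_neq0.
(* This product is [P] without its last factor, $j = 2m$. *)
have E1 : \prod_(0 <= j < 2 * m) (1 / (lucas (n * k + j * n * q))%:R) =
    (lucas (n * k + 2 * (m * n * q)))%:R / P.
  have PE : P = \prod_(0 <= j < 2 * m) (lucas (n * k + j * n * q))%:R *
                (lucas (n * k + 2 * (m * n * q)))%:R.
    by rewrite /P big_nat_recr //= !mulnA.
  under eq_bigr do rewrite div1r.
  by rewrite prodfV PE invfM mulrCA mulfV ?mulr1 // natr_lucas_neq0.
(* Since $n(k+q) + jnq = nk + (j+1)nq$, this product is [P] without its first factor, $j = 0$. *)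
have E2 : \prod_(0 <= j < 2 * m) (1 / (lucas (n * (k + q) + j * n * q))%:R) =
    (lucas (n * k))%:R / P.
  have PE : P = (lucas (n * k))%:R *
      \prod_(0 <= j < 2 * m) (lucas (n * (k + q) + j * n * q))%:R.
    rewrite /P big_nat_recl //= !mul0n addn0; congr (_ * _).
    by apply: eq_bigr => j _; congr (lucas _)%:R; lia.
  under eq_bigr do rewrite div1r.
  by rewrite prodfV PE invfM mulrA mulfV ?mul1r // natr_lucas_neq0.
rewrite E1 E2 -/P.
have F0 : (fib (m * n * q))%:R != 0 :> R.
  by rewrite pnatr_eq0 -lt0n fib_gt0 // !muln_gt0 m0 n0.
have /eqP := lucas_sub_fib_mul R (n * k) (m * n * q).
rewrite subr_eq => /eqP ->.
by field; rewrite P0 F0.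
Qed.

(** The factor $j = 0$ alone gives decay: $1/L_{nk} \le 1/k$, while the other factors are at most
    1. *)
Lemma lucas_term_cvg0 : (0 < m)%N -> (0 < n)%N -> lucas_term @ \oo --> 0.
Proof.
move=> m0 n0; apply/norm_cvg0P; rewrite -cvg_shiftS.
apply: (@squeeze_cvgr _ _ _ _ (cst 0) (@harmonic R)); last 2 first.
- exact: cvg_cst.
- exact: cvg_harmonic.
apply: nearW => k /=; rewrite normr_ge0 /= normrM normrX normrN1 expr1n mul1r.
(* As $m > 0$, the product is nonempty and its factor $j = 0$ can be split off. *)
have [p ->] : exists p, (2 * m = p.+1)%N by exists (2 * m).-1; lia.
rewrite normr_prod big_nat_recl //= mul0n addn0 !div1r -[leRHS]mulr1.
have inv_le i : `|1 / (lucas i)%:R : R| <= 1.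
  by rewrite div1r ger0_norm ?invr_ge0 // invf_le1 ?ltr0n ?ler1n ?lucas_gt0.
rewrite ler_pM ?normr_ge0 //.
- by apply: prodr_ge0 => *; exact: normr_ge0.
- rewrite ger0_norm ?invr_ge0 // lef_pV2 ?posrE ?ltr0n ?lucas_gt0 // ler_nat.
  by apply: leq_trans (leq_lucas _); rewrite leq_pmull.
- by apply: prodr_ile1 => j _; rewrite normr_ge0 inv_le.
Qed.

End InverseLucasProduct.

Theorem theorem2p23 (R : realType) (m n q : nat)
    (hm : (0 < m)%N) (hn : (0 < n)%N) (hq : (0 < q)%N)
    (hpar : ~~ odd q \/ odd (m * n * q)) :
  (fun N : nat => \sum_(1 <= k < N.+1)
     (-1) ^+ k.-1 * ((fib (n * k + m * n * q))%:R /
        \prod_(0 <= j < (2 * m).+1) (lucas (n * k + j * n * q))%:R))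
    @ \oo -->
  (1 / (5 * (fib (m * n * q))%:R) *
     \sum_(1 <= k < q.+1)
       ((-1) ^+ k.-1 *
        \prod_(0 <= j < 2 * m) (1 / (lucas (n * k + j * n * q))%:R)) : R).
Proof.
set c : R := 1 / _; set S := \sum_(1 <= k < q.+1) _.
pose T := lucas_term R m n q.
have -> : (fun N : nat => \sum_(1 <= k < N.+1)
     (-1) ^+ k.-1 * ((fib (n * k + m * n * q))%:R /
        \prod_(0 <= j < (2 * m).+1) (lucas (n * k + j * n * q))%:R)) =
  (fun N => c * (S - \sum_(1 <= k < q.+1) T (k + N)%N)).
  apply/funext => N; rewrite -(sum_sub_shift T) mulr_sumr.
  by apply: eq_big_nat => k /andP[k0 _]; exact: lucas_term_sub_shift.
rewrite -[X in _ --> c * X]subr0.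
apply: cvgMl_tmp; apply: cvgB; first exact: cvg_cst.
(* Writing 0 as a sum of $q$ zeros lets the limit be taken term by term, the number of terms being
   independent of [N]. *)
rewrite [X in _ --> X](_ : 0 = \sum_(1 <= k < q.+1) (0 : R)); last first.
  by rewrite big1_eq.
apply: (cvg_big add_continuous) => k _.
under eq_cvg do rewrite addnC.
by have := @lucas_term_cvg0 R m n q hm hn; rewrite -(cvg_shiftn k).
Qed.
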